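(* Let $\ell\ge 3$ be an integer. There exists $n_0=n_0(\ell)$ such that for all integers $n\ge n_0$, $$\operatorname{sat}(K_{n,n,n},K_{\ell,\ell,\ell-2})\ge 6(\ell-1)n-(72\ell^2-40\ell+54).$$
   Context: All graphs are simple. For graphs $F$ and $H$, a subgraph $G$ of $H$ (with $V(G)=V(H)$) is an $F$-saturated subgraph of $H$ if $G$ contains no copy of $F$ as a (not necessarily induced) subgraph, but $G+e$ contains a copy of $F$ for every $e\in E(H)\setminus E(G)$. The number $\operatorname{sat}(H,F)$ is the minimum number of edges in an $F$-saturated subgraph of $H$. The graph $K_{a,b,c}$ is the complete tripartite graph with part sizes $a,b,c$. *)

(* Defs.v *)
From mathcomp Require Import all_boot all_order all_algebra.

Set Implicit Arguments.
Unset Strict Implicit.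
Unset Printing Implicit Defensive.

(* A graph with vertex set V is given by its edge set; it is simple when all
   its edges are unordered pairs of distinct vertices. *)
Notation graph V := {set {set V}}.

Definition simple_graph (V : finType) (G : graph V) : bool :=
  [forall e in G, #|e| == 2].

(* G contains a copy of F as a (not necessarily induced) subgraph.  The map f
   is injective on all vertices of F, isolated ones included. *)
Definition has_copy (U V : finType) (F : graph U) (G : graph V) : bool :=
  [exists f : {ffun U -> V},
    injectiveb f && [forall e in F, f @: e \in G]].

(* Subgraphs of H are spanning, so they are the subsets of the edge set of H. *)
Definition saturated (U V : finType) (H : graph V) (F : graph U)
    (G : graph V) : bool :=
  [&& G \subset H, ~~ has_copy F G &
      [forall e in H :\: G, has_copy F (e |: G)]].

(* Every candidate has at most #|H| edges, so the default value #|H| is never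
   smaller than the minimum; it only matters when no saturated subgraph exists,
   which is excluded by satP below as soon as F has an edge. *)
Definition sat (U V : finType) (H : graph V) (F : graph U) : nat :=
  \big[minn/#|H|]_(G : graph V | saturated H F G) #|G|.

Definition tripart (a b c : nat) (x : 'I_a + 'I_b + 'I_c) : 'I_3 :=
  match x with
  | inl (inl _) => inord 0
  | inl (inr _) => inord 1
  | inr _ => inord 2
  end.

Definition Ktri (a b c : nat) : graph ('I_a + 'I_b + 'I_c)%type :=
  [set e | [exists u, exists v,
     (tripart u != tripart v) && (e == [set u; v])]].

Lemma Ktri_simple (a b c : nat) : simple_graph (Ktri a b c).
Proof.
apply/forall_inP => e; rewrite inE => /existsP[u /existsP[v /andP[uv /eqP->]]].
by rewrite cards2; case: (eqVneq u v) uv => // ->; rewrite eqxx.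
Qed.

Lemma Ktri_adj (a b c : nat) (u v : 'I_a + 'I_b + 'I_c) :
  ([set u; v] \in Ktri a b c) = (tripart u != tripart v).
Proof.
rewrite inE; apply/existsP/idP => [[x /existsP[y /andP[xy /eqP/setP E]]]|uv].
  move: (E x) (E y).
  rewrite !inE !eqxx orbT => /orP[]/eqP xE /orP[]/eqP yE; move: xy;
    by rewrite xE yE ?eqxx // eq_sym.
by exists u; apply/existsP; exists v; rewrite uv eqxx.
Qed.

Lemma Ktri_neq0 (a b c : nat) : 0 < a -> 0 < b -> Ktri a b c != set0.
Proof.
move=> a0 b0; apply/set0Pn.
exists [set inl (inl (Ordinal a0)); inl (inr (Ordinal b0))].
by rewrite Ktri_adj /= -val_eqE /= !inordK.
Qed.

Lemma satP (U V : finType) (H : graph V) (F : graph U) : F != set0 ->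
  (exists2 G, saturated H F G & #|G| = sat H F) /\
  (forall G, saturated H F G -> sat H F <= #|G|).
Proof.
move=> F0.
have minP G : saturated H F G -> sat H F <= #|G|.
  move=> sG; rewrite /sat; elim: (index_enum _) (mem_index_enum G) => //= K s IH.
  rewrite inE big_cons => /predU1P[<-|/IH Gs]; first by rewrite sG geq_minl.
  by case: ifP => // _; rewrite geq_min Gs orbT.
split=> //.
pose P := [pred G : graph V | (G \subset H) && ~~ has_copy F G].
have P0 : P set0.
  rewrite /= sub0set; apply/existsP => -[f /andP[_ /forall_inP fF]].
  by case/set0Pn: F0 => e /fF; rewrite inE.
have [M /maxsetP[/andP[MH MF] Mmax] _] := maxset_exists P0.
have sM : saturated H F M.
  rewrite /saturated MH MF; apply/forall_inP => e /setDP[eH eM].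
  apply: contraNT eM => nc; rewrite -(Mmax (e |: M)) ?setU11 ?subsetUr //.
  by rewrite /= nc subUset sub1set eH MH.
case: (arg_minnP (fun G : graph V => #|G|) sM) => G sG Gmin.
exists G => //; apply/eqP; rewrite eqn_leq minP // andbT /sat.
elim/big_ind: _ => //; first by case/and3P: sG => /subset_leq_card.
by move=> x y Gx Gy; rewrite leq_min Gx.
Qed.

(* Main.v *)
Require Import Defs.
From mathcomp Require Import all_boot all_order all_algebra.
From mathcomp Require Import zify.
Import Order.TTheory GRing.Theory Num.Theory.

Set Implicit Arguments.
Unset Strict Implicit.
Unset Printing Implicit Defensive.

(** Let [G] be saturated with fewer than [6 * (l - 1) * n] edges.  Every edge
has at most one end in a given part, so by averaging each part contains a
vertex of degree below [6 * (l - 1)] ([exists_low_degree]).  Pick one such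
vertex per part and let the core [S] be the union of their neighbourhoods; its
size is at most [18 * (l - 1)].  The bound follows once the [3 * n - #|S|]
vertices outside [S] can be charged [2 * (l - 1)] edges each, with no edge
charged twice.

Let [v] be outside [S], let [u] be the chosen vertex of another part and [k]
the third part.  As [uv] is a missing edge, adding it creates a copy of the
complete tripartite graph.  Its vertices in part [k] are common neighbours of
[u] and [v], hence core neighbours of [v]: there are at least [l - 2] of them.
Letting [u] vary, [v] has at least [l - 2] core neighbours in each of the two
other parts.  This is short of the target by one in each part, and the small
part of the copy supplies the missing edges ([core_dichotomy]).  If the copy
has fewer than [l] vertices in part [k], then it has [l] in the parts of [u]
and [v].  So [v] has [l - 1] neighbours in the part of [u], and each of them is
joined to [l - 1] neighbours of [u] in the part of [v], all of which lie in
[S].  Either all these neighbours of [v] are in [S], or one of them, [a], is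
outside [S] and has [l - 1] core neighbours in the part of [v].

Accordingly [v] is charged all its edges into [S], and the edge [va] when [v]
has fewer than [l - 1] core neighbours in the part of [a] while [a] has at
least [l - 1] in the part of [v] ([core_arc]).  This condition is asymmetric in
[v] and [a], so that no edge is charged to both ends.  A vertex [v] then gets
at least [l - 1] edges to each other part, or [l] to one and [l - 2] to the
other: [2 * (l - 1)] in all cases ([core_arc_outdegree]). *)

(** * Orienting edges *)

(** An asymmetric relation selects at most one of the two orientations of each
edge; this is the device behind both edge counts of the proof. *)
Lemma sum_oriented_le (V : finType) (G : graph V) (R : rel V) :
  (forall v x, R v x -> [set v; x] \in G) ->
  (forall v x, R v x -> ~~ R x v) ->
  \sum_v #|[set x | R v x]| <= #|G|.
Proof.
move=> RG Rasym.
pose Q := [set p : V * V | R p.1 p.2].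
have -> : \sum_v #|[set x | R v x]| = #|Q|.
  rewrite -sum1_card (eq_bigl (fun p : V * V => true && R p.1 p.2)); last first.
    by move=> p; rewrite inE.
  rewrite -(pair_big_dep xpredT R (fun _ _ => 1%N)) /=.
  by apply: eq_bigr => v _; rewrite -sum1_card; apply: eq_bigl => x; rewrite inE.
have inj : {in Q &, injective (fun p : V * V => [set p.1; p.2])}.
  move=> [v x] [w y]; rewrite !inE /= => Rvx Rwy /setP E.
  have := E v; have := E x; rewrite !inE !eqxx orbT /=.
  case/esym/orP => /eqP xE; case/esym/orP => /eqP vE; subst x v => //.
  - by move: (Rasym _ _ Rvx); rewrite Rvx.
  - by move: (Rasym _ _ Rwy); rewrite Rvx.
  - by move: (Rasym _ _ Rvx); rewrite Rvx.
rewrite -(card_in_imset inj); apply/subset_leq_card/subsetP => e.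
by case/imsetP => -[v x]; rewrite inE /= => Rvx ->; apply: RG.
Qed.

(** * Copies created by a missing edge *)

Definition layer (V : finType) (col : V -> 'I_3) (A : {set V}) (c : 'I_3) :=
  [set x in A | col x == c].

Definition nbr (V : finType) (G : graph V) (v : V) := [set x | [set v; x] \in G].

(** [P] is the vertex set of a complete tripartite graph of which [G] contains
all edges except [uv].  The last two clauses are what remains of the part sizes
[l], [l], [l - 2] when it is not known which part of the host each of them goes
to: at most one layer is small, and it has at least [l - 2] elements. *)
Definition near_copy (V : finType) (col : V -> 'I_3) (l : nat) (G : graph V)
    (u v : V) (P : {set V}) : Prop :=
  [/\ u \in P, v \in P,
      forall x y, x \in P -> y \in P -> col x != col y ->
        [set x; y] != [set u; v] -> [set x; y] \in G,
      forall c, l - 2 <= #|layer col P c| &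
      forall c d, c != d -> #|layer col P c| < l -> l <= #|layer col P d|].

Lemma card_tripart (a b c : nat) (i : 'I_3) :
  #|[set x : 'I_a + 'I_b + 'I_c | tripart x == i]| =
    nth 0 [:: a; b; c] i.
Proof.
rewrite -sum1dep_card big_sumType /= big_sumType /=.
have E (j : nat) m : j < 3 ->
    \sum_(k < m | (inord j : 'I_3) == i) 1 = if j == i then m else 0.
  move=> j3; have -> : ((inord j : 'I_3) == i) = (j == i).
    by rewrite -val_eqE /= inordK.
  by case: (j == i); rewrite ?big_pred0_eq // sum1_card card_ord.
by rewrite !E //; case: i {E} => [[|[|[|]]]] //= _; rewrite ?addn0.
Qed.

(** A complete tripartite graph with nonempty parts has only one proper
3-colouring up to renaming, so each part of the copy fills exactly one part of
the host, and layer sizes can be read off up to a permutation of the parts. *)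
Lemma saturated_near_copy (n l : nat) (G : graph ('I_n + 'I_n + 'I_n)%type) u v :
  3 <= l -> saturated (Ktri n n n) (Ktri l l (l - 2)) G ->
  tripart u != tripart v -> [set u; v] \notin G ->
  exists P, near_copy (@tripart n n n) l G u v P.
Proof.
move=> l3 /and3P[GH nF /forall_inP satG] uv uvG.
have uvH : [set u; v] \in Ktri n n n by rewrite Ktri_adj.
have /existsP[f /andP[/injectiveP f_inj /forall_inP fF]] :
  has_copy (Ktri l l (l - 2)) ([set u; v] |: G).
  by apply: satG; rewrite in_setD uvG uvH.
have fadj x y : tripart x != tripart y -> [set f x; f y] \in [set u; v] |: G.
  by rewrite -Ktri_adj => /fF; rewrite imsetU1 imset_set1.
have fcol x y : tripart x != tripart y -> tripart (f x) != tripart (f y).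
  move/fadj; rewrite -[_ != _]Ktri_adj; apply: subsetP.
  by rewrite subUset sub1set uvH.
have sz (i : 'I_3) : l - 2 <= nth 0 [:: l; l; l - 2] i.
  by case: i => [[|[|[|]]]] //= _; rewrite ?leq_subr.
(* Nonemptiness of the third part is where [3 <= l] matters. *)
have rep (i : 'I_3) : exists x : 'I_l + 'I_l + 'I_(l - 2), tripart x == i.
  have /card_gt0P[x] : 0 < #|[set x : 'I_l + 'I_l + 'I_(l - 2) | tripart x == i]|.
    by rewrite card_tripart; apply: leq_trans (sz i); rewrite subn_gt0.
  by rewrite inE => xi; exists x.
pose r i := xchoose (rep i).
have rE i : tripart (r i) = i by apply/eqP; exact: xchooseP (rep i).
(* [s] is the permutation of the parts induced by the embedding [f]. *)
pose s i := tripart (f (r i)).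
have s_inj : injective s.
  by move=> i j /eqP; apply: contraTeq => ij; apply: fcol; rewrite !rE.
have sE x : tripart (f x) = s (tripart x).
  have [t ts st] := injF_bij s_inj.
  rewrite -[LHS]st; congr s; apply/eqP; apply: contraT => tx.
  have := @fcol x (r (t (tripart (f x)))).
  by rewrite rE eq_sym tx -/(s _) st eqxx => /(_ isT).
pose P := [set f x | x in setT].
have szP (i : 'I_3) : nth 0 [:: l; l; l - 2] i <= #|layer (@tripart n n n) P (s i)|.
  rewrite -card_tripart -(card_imset _ f_inj).
  apply/subset_leq_card/subsetP => _ /imsetP[x /[!inE] /eqP xi ->].
  by rewrite sE xi eqxx andbT imset_f.
(* A copy avoiding an end of the new edge would be a copy in [G] itself. *)
have used w w' : [set u; v] = [set w; w'] -> w \in P.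
  move=> E; apply: contraR nF => wP; apply/existsP; exists f.
  apply/andP; split; first exact/injectiveP.
  apply/forall_inP => e eF; have := fF e eF; rewrite inE => /orP[|//].
  rewrite inE E => /eqP fe; case/negP: wP.
  have : w \in f @: e by rewrite fe set21.
  by case/imsetP => x _ ->; apply: imset_f.
exists P; split.
- exact: used (erefl _).
- by apply: (used v u); rewrite setUC.
- move=> _ _ /imsetP[x _ ->] /imsetP[y _ ->]; rewrite !sE (inj_eq s_inj) => xy.
  by have := fadj _ _ xy; rewrite !inE => /orP[->|].
- move=> c; have [t _ st] := injF_bij s_inj; rewrite -(st c).
  exact: leq_trans (sz _) (szP _).
- move=> c d; have [t _ st] := injF_bij s_inj; rewrite -(st c) -(st d).
  rewrite (inj_eq s_inj) => cd; have := szP (t c); have := szP (t d).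
  move: cd; move: (t c) (t d) => i j; rewrite -val_eqE /= => ij Pj Pi.
  move=> /(leq_ltn_trans Pi) {Pi}; apply: contraLR; rewrite -ltnNge -leqNgt.
  move/(leq_ltn_trans Pj) => {Pj}.
  by case: i j ij => [[|[|[|]]]] //= _ [[|[|[|]]]] //= _; rewrite ltnn.
Qed.

(** * Charging edges to the vertices outside a core *)

Section Core.
Variables (V : finType) (col : V -> 'I_3) (l : nat) (G : graph V) (S : {set V}).

Notation deg_core v c := #|layer col (nbr G v :&: S) c|.

(** The layer of [P] in part [k] consists of core neighbours of [v].  When it is
small, the other two layers have at least [l] vertices; [A] and [B] are these
layers without [u] and [v].  Then [A] lies in the neighbourhood of [v], [B] in
that of [u], hence in [S], and [A] is completely joined to [B], so any vertex
of [A] outside [S] can serve as [a]. *)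
Lemma core_dichotomy (u v : V) (k : 'I_3) P :
  near_copy col l G u v P -> nbr G u \subset S ->
  v \notin S -> col u != col v -> k != col u -> k != col v ->
  l - 2 <= deg_core v k /\
  (deg_core v k < l -> l - 1 <= deg_core v (col u) \/
    exists2 a, a \in layer col (nbr G v) (col u) :\: S &
               l - 1 <= deg_core a (col v)).
Proof.
move=> [uP vP adj szP szP2] uS vS uv ku kv.
have subk : layer col P k \subset layer col (nbr G v :&: S) k.
  apply/subsetP => x; rewrite !inE => /andP[xP /eqP xk].
  have ux : x != u by apply: contraNneq ku => <-; rewrite xk.
  have vx : x != v by apply: contraNneq kv => <-; rewrite xk.
  have notuv w : [set w; x] != [set u; v].
    by apply/eqP => /setP/(_ x); rewrite !inE eqxx (negbTE ux) (negbTE vx) orbT.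
  rewrite xk eqxx andbT adj ?xk 1?[_ == k]eq_sym //=; apply: (subsetP uS).
  by rewrite inE adj ?xk 1?[_ == k]eq_sym.
split=> [|ltl]; first exact: leq_trans (szP k) (subset_leq_card subk).
have {}ltl := leq_ltn_trans (subset_leq_card subk) ltl.
pose A := layer col P (col u) :\ u; pose B := layer col P (col v) :\ v.
have cardA : l - 1 <= #|A|.
  have := szP2 _ _ ku ltl; rewrite (cardsD1 u) inE uP eqxx -/A; lia.
have cardB : l - 1 <= #|B|.
  have := szP2 _ _ kv ltl; rewrite (cardsD1 v) inE vP eqxx -/B; lia.
have adjA x : x \in A -> x \in layer col (nbr G v) (col u).
  rewrite !inE => /andP[xu /andP[xP /eqP xc]]; rewrite xc eqxx andbT.
  apply: adj => //; first by rewrite xc eq_sym.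
  apply/eqP => /setP/(_ x); rewrite !inE eqxx orbT (negbTE xu) /=.
  by move/esym/eqP => xv; case/eqP: uv; rewrite -xc xv.
have adjAB x : x \in A -> B \subset layer col (nbr G x :&: S) (col v).
  rewrite !inE => /andP[xu /andP[xP /eqP xc]]; apply/subsetP => y.
  rewrite !inE => /andP[yv /andP[yP /eqP yc]]; rewrite yc eqxx andbT.
  apply/andP; split.
    apply: adj => //; first by rewrite xc yc.
    apply/eqP => /setP/(_ x); rewrite !inE eqxx (negbTE xu) /=.
    by move/esym/eqP => xv; case/eqP: uv; rewrite -xc xv.
  apply: (subsetP uS); rewrite inE; apply: adj => //; first by rewrite yc.
  apply/eqP => /setP/(_ y); rewrite !inE eqxx orbT (negbTE yv) orbF.
  by move/esym/eqP => yu; case/eqP: uv; rewrite -yc yu.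
have [/subsetP AS|/subsetPn[a aA aS]] := boolP (A \subset S).
  left; apply: leq_trans cardA _; apply/subset_leq_card/subsetP => x xA.
  by have := adjA x xA; have := AS x xA; rewrite !inE => -> /andP[-> ->].
right; exists a; first by rewrite inE aS adjA.
exact: leq_trans cardB (subset_leq_card (adjAB _ aA)).
Qed.

(** The orientation that decides which end an edge is charged to: [v] pays for
[vx].  Between two vertices outside the core, the payer is the end that lacks
core neighbours in the part of the other, provided that the other end does not
lack any in return. *)
Definition core_arc (v x : V) : bool :=
  [&& v \notin S, [set v; x] \in G &
      (x \in S) ||
      ((deg_core v (col x) < l - 1) && (l - 1 <= deg_core x (col v)))].

Lemma core_arc_asym v x : core_arc v x -> ~~ core_arc x v.
Proof.
case/and3P=> vS _ /orP[xS|/andP[_ le]]; apply/negP.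
  by case/and3P; rewrite xS.
by case/and3P=> xS _; rewrite (negbTE vS) /= ltnNge le.
Qed.

Lemma core_arc_layer v c : v \notin S ->
  deg_core v c <= #|layer col [set x | core_arc v x] c|.
Proof.
move=> vS; apply/subset_leq_card/subsetP => x.
by rewrite !inE /core_arc vS => /andP[/andP[-> ->] ->].
Qed.

(** If [v] has only [l - 2] core neighbours in part [c], then [a] is a charged
neighbour in that part besides them, which makes up for the missing one. *)
Lemma core_arc_layer_repaired v c :
  v \notin S -> l - 2 <= deg_core v c ->
  (l - 1 <= deg_core v c \/
    exists2 a, a \in layer col (nbr G v) c :\: S &
               l - 1 <= deg_core a (col v)) ->
  l - 1 <= #|layer col [set x | core_arc v x] c|.
Proof.
move=> vS lo ex; have [/leq_trans-> //|lt] := leqP (l - 1) (deg_core v c).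
  exact: core_arc_layer.
case: ex => [|[a]]; first by rewrite leqNgt lt.
rewrite !inE => /and3P[aS av /eqP ac] la.
have sub : a |: layer col (nbr G v :&: S) c \subset
           layer col [set x | core_arc v x] c.
  apply/subsetP => x; rewrite !inE => /orP[/eqP->|].
    by rewrite /core_arc vS av ac lt la eqxx orbT.
  by rewrite /core_arc vS => /andP[/andP[-> ->] ->].
apply: leq_trans (subset_leq_card sub); rewrite cardsU1 !inE (negbTE aS) andbF /=.
lia.
Qed.

(** A deficit in part [c] need not be repaired when the other part [k] holds [l]
core neighbours, since [l + (l - 2)] is already the target; otherwise
[core_dichotomy] repairs it.  The vertices [w c] are the centres whose
neighbourhoods make up the core. *)
Lemma core_arc_outdegree (w : 'I_3 -> V) v :
  (forall c, col (w c) = c) -> (forall c, nbr G (w c) \subset S) ->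
  (forall u v, col u != col v -> [set u; v] \notin G ->
     exists P, near_copy col l G u v P) ->
  v \notin S -> 2 * (l - 1) <= #|[set x | core_arc v x]|.
Proof.
move=> wcol wS sat vS.
have dich c k : c != col v -> k != c -> k != col v ->
    l - 2 <= deg_core v k /\
    (deg_core v k < l -> l - 1 <= deg_core v c \/
      exists2 a, a \in layer col (nbr G v) c :\: S & l - 1 <= deg_core a (col v)).
  move=> cv kc kv.
  have wv : [set w c; v] \notin G.
    by apply: contra vS => wvG; apply: (subsetP (wS c)); rewrite inE.
  have [|P nP] := sat (w c) v _ wv; first by rewrite wcol.
  by have := core_dichotomy (k := k) nP (wS c) vS; rewrite wcol; apply.
have [c [k [cv kv kc]]] : exists c k, [/\ c != col v, k != col v & k != c].
  case: (col v) => [[|[|[|]]]] // i.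
  - by exists (inord 1), (inord 2); rewrite -!val_eqE /= !inordK.
  - by exists (inord 0), (inord 2); rewrite -!val_eqE /= !inordK.
  - by exists (inord 0), (inord 1); rewrite -!val_eqE /= !inordK.
have [lok exc] := dich c k cv kc kv.
have ck : c != k by rewrite eq_sym.
have [loc exk] := dich k c kv ck cv.
pose O := [set x | core_arc v x].
have split_out : #|layer col O c| + #|layer col O k| <= #|O|.
  rewrite -cardsUI [X in _ + X](_ : _ = 0) ?addn0; last first.
    apply/eqP; rewrite cards_eq0; apply/eqP/setP => x; rewrite !inE.
    by apply/negP => /andP[/andP[_ /eqP->] /andP[_]]; rewrite (negbTE ck).
  by apply/subset_leq_card/subsetP => x; rewrite !inE => /orP[]/andP[].
apply: leq_trans split_out; have := core_arc_layer c vS.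
have := core_arc_layer k vS; rewrite -/O.
have [/exc/(core_arc_layer_repaired vS loc)|] := ltnP (deg_core v k) l;
have [/exk/(core_arc_layer_repaired vS lok)|] := ltnP (deg_core v c) l;
rewrite -/O; lia.
Qed.

End Core.

(** * Low-degree vertices and the final count *)

(** Orienting every edge that meets part [c] away from that part counts it once,
so the degrees in one part add up to at most the number of edges. *)
Lemma exists_low_degree (V : finType) (col : V -> 'I_3) (G : graph V) (c : 'I_3)
    (n d : nat) :
  (forall x y, [set x; y] \in G -> col x != col y) ->
  #|[set x | col x == c]| = n -> #|G| < d * n ->
  exists2 u, col u = c & #|nbr G u| < d.
Proof.
move=> Gcol cardc.
have [/existsP[u /andP[/eqP uc ltu]]|noLow] :=
  boolP [exists u, (col u == c) && (#|nbr G u| < d)]; first by exists u.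
rewrite ltnNge => /negP[].
pose R v x := (col v == c) && ([set v; x] \in G).
apply: leq_trans (@sum_oriented_le V G R _ _); last first.
- by rewrite /R => v x /andP[/eqP <- /Gcol]; rewrite eq_sym => /negbTE->.
- by move=> v x /andP[].
rewrite mulnC -cardc -sum_nat_const [leqRHS](bigID (mem [set x | col x == c])) /=.
apply: leq_trans (leq_addr _ _); apply: leq_sum => v; rewrite inE => /eqP vc.
rewrite leqNgt; apply: contra noLow => ltv; apply/existsP; exists v.
rewrite vc eqxx; apply: leq_ltn_trans ltv; apply/subset_leq_card/subsetP => x.
by rewrite !inE /R vc eqxx.
Qed.

(** The error term is [2 * (l - 1)] times the bound [18 * (l - 1)] on the size of
the core. *)
Lemma saturated_size (l n : nat) (G : graph ('I_n + 'I_n + 'I_n)%type) :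
  3 <= l -> saturated (Ktri n n n) (Ktri l l (l - 2)) G ->
  6 * (l - 1) * n <= #|G| + 36 * (l - 1) ^ 2.
Proof.
move=> l3 satG; pose col := @tripart n n n.
have [|small] := leqP (6 * (l - 1) * n) #|G|; first by move/leq_trans; apply; lia.
have Gcol x y : [set x; y] \in G -> col x != col y.
  by case/and3P: satG => /subsetP GH _ _ /GH; rewrite Ktri_adj.
have low c : exists u, (col u == c) && (#|nbr G u| < 6 * (l - 1)).
  have [|u <- ltu] := @exists_low_degree _ col G c n (6 * (l - 1)) Gcol _ small.
    by rewrite card_tripart; case: c => [[|[|[|]]]].
  by exists u; rewrite eqxx.
pose w c := xchoose (low c).
have wP c : (col (w c) == c) && (#|nbr G (w c)| < 6 * (l - 1)) := xchooseP (low c).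
pose S := \bigcup_c nbr G (w c).
have cardS : #|S| <= 3 * (6 * (l - 1)).
  apply: leq_trans (_ : _ <= \sum_(c < 3) #|nbr G (w c)|) _.
    rewrite /S; elim/big_rec2: _ => [|c m A _ IH]; first by rewrite cards0.
    by rewrite cardsU; apply: leq_trans (leq_subr _ _) _; rewrite leq_add2l.
  rewrite -[X in _ <= X * _]card_ord -sum_nat_const.
  by apply: leq_sum => c _; case/andP: (wP c) => _ /ltnW.
have cardV : #|S| + #|~: S| = 3 * n by rewrite cardsC !card_sum !card_ord; lia.
have : \sum_(v in ~: S) 2 * (l - 1) <= #|G|.
  apply: leq_trans (@sum_oriented_le _ G (core_arc col l G S) _ _).
  - rewrite [leqRHS](bigID (mem (~: S))) /=; apply: leq_trans (leq_addr _ _).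
    apply: leq_sum => v; rewrite inE => vS.
    apply: (@core_arc_outdegree _ col l G S w) => //.
    + by move=> c; case/andP: (wP c) => /eqP.
    + by move=> c; exact: (bigcup_sup c).
    + by move=> u v'; apply: saturated_near_copy.
  - by move=> v x /and3P[].
  - exact: core_arc_asym.
rewrite sum_nat_const; nia.
Qed.

Theorem theorem9 (l : nat) (hl : (3 <= l)%N) :
  exists n0 : nat, forall n : nat, (n0 <= n)%N ->
    (6 * (l%:Z - 1) * n%:Z - (72 * l%:Z ^+ 2 - 40 * l%:Z + 54)
       <= (sat (Ktri n n n) (Ktri l l (l - 2)))%:Z)%R.
Proof.
exists 0 => n _.
have l0 : 0 < l by apply: leq_trans hl.
have [[G satG <-] _] := Defs.satP (Ktri n n n) (Ktri_neq0 (l - 2) l0 l0).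
have := saturated_size hl satG; nia.
Qed.
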